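(* Let ${\mathbf{INF}^\iota}'$ be the natural deduction system described in the context. For any deduction $\Pi$ in ${\mathbf{INF}^\iota}'$ of a formula $A$ from a set of undischarged assumptions $\Gamma$, there is a deduction in ${\mathbf{INF}^\iota}'$ of $A$ whose undischarged assumptions are among the formulas in $\Gamma$ and which is in normal form.
   Context: Language: first-order formulas built from atomic formulas (predicate letters applied to terms, identities $t_1=t_2$, formulas $\exists! t$ read ''$t$ exists'', and $\bot$), using $\land,\lor,\rightarrow$, the quantifiers $\forall x,\exists x$, and a binary quantifier $\iota$: if $F,G$ are formulas and $x$ a variable, $\iota x[F,G]$ is a formula (''The $F$ is $G$'') binding $x$ in $F$ and $G$. Terms may be built with function letters. $A_t^x$ is the result of substituting $t$ for the free occurrences of $x$ in $A$, where $t$ is free for $x$ in $A$. The system ${\mathbf{INF}^\iota}'$ has the following rules (assumptions in $[\ ]$ are discharged). Propositional: $\land I$: from $A,B$ infer $A\land B$; $\land E$: from $A\land B$ infer $A$, and infer $B$; $\rightarrow I$: from a deduction of $B$ from $[A]$ infer $A\rightarrow B$; $\rightarrow E$: from $A\rightarrow B$ and $A$ infer $B$; $\lor I$: from $A$ (or $B$) infer $A\lor B$; $\lor E$: from $A\lor B$, a deduction of $C$ from $[A]$ and one of $C$ from $[B]$, infer $C$; $\bot E$: from $\bot$ infer $B$, with $B$ atomic. Quantifiers: $\forall I$: from a deduction of $A_y^x$ from $[\exists! y]$ infer $\forall xA$, where $y$ is not free in undischarged assumptions other than $\exists! y$, and $y$ is $x$ or not free in $A$. $\forall E$: from $\forall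 xA$ and $\exists! t$ infer $A_t^x$. $\exists I$: from $A_t^x$ and $\exists! t$ infer $\exists xA$. $\exists E$: from $\exists xA$ and a deduction of $C$ from $[A_y^x],[\exists! y]$ infer $C$, where $y$ is not free in $C$ nor undischarged assumptions other than $A_y^x,\exists! y$, and $y$ is $x$ or not free in $A$. Identity and strictness: $=I^n$: from $\exists! t$ infer $t=t$. $=E$ (Leibniz' Law): from $t_1=t_2$ and $A_{t_1}^x$ infer $A_{t_2}^x$, with $A$ atomic, $x$ free in $A$, $t_1,t_2$ distinct. $AD$: from atomic $P t_1\ldots t_n$ ($P$ any $n$-place predicate letter, including identity) infer $\exists! t_i$. $FD$: from $\exists! f t_1\ldots t_n$ infer $\exists! t_i$. $\iota$ rules: $\iota I$: from $F_t^x$, $G_t^x$, $\exists! t$ and a deduction of $z=t$ from $[F_z^x],[\exists! z]$, infer $\iota x[F,G]$; $t$ free for $x$ in $F,G$; $z$ distinct from $x$, not free in $t$, not free in undischarged assumptions of that subdeduction other than $F_z^x,\exists! z$. $\iota E^1$: from $\iota x[F,G]$ and a deduction of $C$ from $[F_z^x],[G_z^x],[\exists! z]$ infer $C$, where $z$ is not free in $C$ nor undischarged assumptions other than these three, and $z$ is $x$ or not free in $F,G$. $\iota E^{2A}$: from $\iota x[F,G]$, $\exists! t_1$, $\exists! t_2$, $F_{t_1}^x$, $F_{t_2}^x$ and $A_{t_1}^x$ infer $A_{t_2}^x$, where $A$ is atomic and $t_1,t_2$ are free for $x$ in $F$. Normal form: The major premise of an elimination rule ($\land E,\rightarrow E,\lor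 E,\forall E,\exists E,\iota E^1,\iota E^{2A}$) is the premise containing the constant the rule governs; others are minor. A maximal formula is a formula occurrence that is the conclusion of an introduction rule ($\land I,\rightarrow I,\lor I,\forall I,\exists I,\iota I$) and the major premise of an elimination rule for its main connective; in addition, an identity $t_1=t_2$ concluded by $\iota E^{2A}$ (with $A_{t_1}^x$ being $t_1=t_1$) and used as the identity premise of $=E$ also counts as a maximal formula. A segment is a sequence of occurrences of the same formula, each (except the last) a minor premise of $\lor E$, $\exists E$ or $\iota E^1$ whose conclusion is the next one; it is maximal if its first formula is concluded by an introduction rule for its main connective and its last formula is the major premise of an elimination rule for it. A deduction is in normal form if it contains no maximal formulas and no maximal segments.
   Formalization: Formulas are identified up to renaming of bound variables, and in ιI the variable z is also required not to be free in F; without this condition ιI is unsound (e.g. F = R(x,z)) and an ιI/ιE^{2A} detour cannot always be removed. *)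

(* Defs.v *)
From mathcomp Require Import all_boot.
From Stdlib Require List.

Set Implicit Arguments.
Unset Strict Implicit.
Unset Printing Implicit Defensive.

(* Formulas are taken up to renaming of bound variables, in de Bruijn form:
   [Var n] is a variable, and [All], [Exi], [Iota] bind index 0.  Substitution
   is capture-avoiding, so "t is free for x in A" always holds.  Without this
   identification normal forms need not exist: with named formulas,
     forall w forall u R(w,u), E! u  |-  forall v R(u,v)
   has only deductions with a detour through forall y forall v R(y,v), since u
   is not free for w in forall u R(w,u). *)

Record signature := Signature {
  funs : Type;  farity : funs -> nat;
  preds : Type; parity : preds -> nat }.

Inductive term (L : signature) : Type :=
| Var (n : nat)
| Fn (f : funs L) (ts : {ffun 'I_(farity f) -> term L}).
Arguments Var {L} n.

Inductive form (L : signature) : Type :=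
| Pred (p : preds L) (ts : {ffun 'I_(parity p) -> term L})
| Id (s t : term L)
| Den (t : term L)               (* E! t, "t exists" *)
| Bot
| And (A B : form L)
| Or (A B : form L)
| Imp (A B : form L)
| All (A : form L)
| Exi (A : form L)
| Iota (F G : form L).           (* iota x [F, G], binding x in F and in G *)
Arguments Bot {L}.

Definition atomic (L : signature) (A : form L) : bool :=
  match A with Pred _ _ | Id _ _ | Den _ | Bot => true | _ => false end.

Section Substitution.
Variable L : signature.

Fixpoint tsubst (s : nat -> term L) (t : term L) : term L :=
  match t with
  | Var n => s n
  | Fn f ts => Fn [ffun i => tsubst s (ts i)]
  end.

Definition tshift : term L -> term L := tsubst (fun n => Var n.+1).

Definition up (s : nat -> term L) (n : nat) : term L :=
  if n is m.+1 then tshift (s m) else Var 0.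

Fixpoint subst (s : nat -> term L) (A : form L) : form L :=
  match A with
  | Pred p ts => Pred [ffun i => tsubst s (ts i)]
  | Id t u => Id (tsubst s t) (tsubst s u)
  | Den t => Den (tsubst s t)
  | Bot => Bot
  | And A B => And (subst s A) (subst s B)
  | Or A B => Or (subst s A) (subst s B)
  | Imp A B => Imp (subst s A) (subst s B)
  | All A => All (subst (up s) A)
  | Exi A => Exi (subst (up s) A)
  | Iota F G => Iota (subst (up s) F) (subst (up s) G)
  end.

Definition shift : form L -> form L := subst (fun n => Var n.+1).

(* A_t^x, where x is index 0 of A *)
Definition inst (A : form L) (t : term L) : form L :=
  subst (fun n => if n is m.+1 then Var m else t) A.

Fixpoint toccurs (n : nat) (t : term L) : Prop :=
  match t with
  | Var m => n = m
  | Fn f ts => exists i, toccurs n (ts i)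
  end.

Fixpoint free_in (n : nat) (A : form L) : Prop :=
  match A with
  | Pred p ts => exists i, toccurs n (ts i)
  | Id t u => toccurs n t \/ toccurs n u
  | Den t => toccurs n t
  | Bot => False
  | And A B | Or A B | Imp A B => free_in n A \/ free_in n B
  | All A | Exi A => free_in n.+1 A
  | Iota F G => free_in n.+1 F \/ free_in n.+1 G
  end.

End Substitution.

(* [ded Gamma A]: deductions of A all of whose undischarged assumptions are in
   Gamma.  A premise in which B is discharged has B added to its context.  An
   eigenvariable is index 0 of a premise whose context is [map shift Gamma];
   it is thereby free neither in the remaining undischarged assumptions, nor
   in any shifted formula or term, nor in the quantified formula other than at
   the places where it replaces the bound variable.  In particular z in iota I
   is not free in F; otherwise the rule would be unsound. *)
Inductive ded (L : signature) : seq (form L) -> form L -> Type :=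
| Hyp Gamma A : List.In A Gamma -> ded Gamma A
| AndI Gamma A B : ded Gamma A -> ded Gamma B -> ded Gamma (And A B)
| AndE1 Gamma A B : ded Gamma (And A B) -> ded Gamma A
| AndE2 Gamma A B : ded Gamma (And A B) -> ded Gamma B
| ImpI Gamma A B : ded (A :: Gamma) B -> ded Gamma (Imp A B)
| ImpE Gamma A B : ded Gamma (Imp A B) -> ded Gamma A -> ded Gamma B
| OrI1 Gamma A B : ded Gamma A -> ded Gamma (Or A B)
| OrI2 Gamma A B : ded Gamma B -> ded Gamma (Or A B)
| OrE Gamma A B C :
    ded Gamma (Or A B) -> ded (A :: Gamma) C -> ded (B :: Gamma) C ->
    ded Gamma C
| BotE Gamma B : atomic B -> ded Gamma Bot -> ded Gamma B
| AllI Gamma A : ded (Den (Var 0) :: map (@shift L) Gamma) A ->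
    ded Gamma (All A)
| AllE Gamma A t : ded Gamma (All A) -> ded Gamma (Den t) ->
    ded Gamma (inst A t)
| ExiI Gamma A t : ded Gamma (inst A t) -> ded Gamma (Den t) ->
    ded Gamma (Exi A)
| ExiE Gamma A C :
    ded Gamma (Exi A) ->
    ded (A :: Den (Var 0) :: map (@shift L) Gamma) (shift C) ->
    ded Gamma C
| IdI Gamma t : ded Gamma (Den t) -> ded Gamma (Id t t)
| IdE Gamma A t1 t2 :
    atomic A -> free_in 0 A -> t1 <> t2 ->
    ded Gamma (Id t1 t2) -> ded Gamma (inst A t1) -> ded Gamma (inst A t2)
| AD Gamma p (ts : {ffun 'I_(parity p) -> term L}) i :
    ded Gamma (Pred ts) -> ded Gamma (Den (ts i))
| ADId1 Gamma t1 t2 : ded Gamma (Id t1 t2) -> ded Gamma (Den t1)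
| ADId2 Gamma t1 t2 : ded Gamma (Id t1 t2) -> ded Gamma (Den t2)
| FD Gamma f (ts : {ffun 'I_(farity f) -> term L}) i :
    ded Gamma (Den (Fn ts)) -> ded Gamma (Den (ts i))
| IotaI Gamma F G t :
    ded Gamma (inst F t) -> ded Gamma (inst G t) -> ded Gamma (Den t) ->
    ded (F :: Den (Var 0) :: map (@shift L) Gamma) (Id (Var 0) (tshift t)) ->
    ded Gamma (Iota F G)
| IotaE1 Gamma F G C :
    ded Gamma (Iota F G) ->
    ded (F :: G :: Den (Var 0) :: map (@shift L) Gamma) (shift C) ->
    ded Gamma C
| IotaE2A Gamma F G A t1 t2 :
    atomic A ->
    ded Gamma (Iota F G) -> ded Gamma (Den t1) -> ded Gamma (Den t2) ->
    ded Gamma (inst F t1) -> ded Gamma (inst F t2) -> ded Gamma (inst A t1) ->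
    ded Gamma (inst A t2).

Section NormalForm.
Variable L : signature.
Implicit Types (Gamma : seq (form L)) (A : form L).

Definition by_intro Gamma A (d : ded Gamma A) : Prop :=
  match d with
  | AndI _ _ _ _ _ | ImpI _ _ _ _ | OrI1 _ _ _ _ | OrI2 _ _ _ _
  | AllI _ _ _ | ExiI _ _ _ _ _ | IotaI _ _ _ _ _ _ _ _ => True
  | _ => False
  end.

(* The conclusion of d is the last formula of a segment whose first formula is
   concluded by an introduction rule. *)
Fixpoint segment_from_intro Gamma A (d : ded Gamma A) : Prop :=
  by_intro d \/
  match d with
  | OrE _ _ _ _ _ d1 d2 => segment_from_intro d1 \/ segment_from_intro d2
  | ExiE _ _ _ _ d1 => segment_from_intro d1
  | IotaE1 _ _ _ _ _ d1 => segment_from_intro d1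
  | _ => False
  end.

(* The last rule of d is an elimination rule, and P holds of the deduction of
   its major premise. *)
Definition major_premise (P : forall Gamma A, ded Gamma A -> Prop)
    Gamma A (d : ded Gamma A) : Prop :=
  match d with
  | AndE1 _ _ _ m => P _ _ m
  | AndE2 _ _ _ m => P _ _ m
  | ImpE _ _ _ m _ => P _ _ m
  | OrE _ _ _ _ m _ _ => P _ _ m
  | AllE _ _ _ m _ => P _ _ m
  | ExiE _ _ _ m _ => P _ _ m
  | IotaE1 _ _ _ _ m _ => P _ _ m
  | IotaE2A _ _ _ _ _ _ _ m _ _ _ _ _ => P _ _ m
  | _ => False
  end.

(* d ends with iota E^2A inferring t1 = t2 from t1 = t1. *)
Definition by_iota_identity Gamma A (d : ded Gamma A) : Prop :=
  match d with
  | IotaE2A _ _ _ B t1 t2 _ _ _ _ _ _ _ =>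
      inst B t1 = Id t1 t1 /\ inst B t2 = Id t1 t2
  | _ => False
  end.

(* For an elimination rule the major premise of d is introduced by the rule
   for its main connective exactly when it is introduced at all. *)
Definition maximal_formula Gamma A (d : ded Gamma A) : Prop :=
  major_premise by_intro d \/
  match d with
  | IdE _ _ _ _ _ _ _ m _ => by_iota_identity m
  | _ => False
  end.

Definition maximal_segment Gamma A (d : ded Gamma A) : Prop :=
  major_premise segment_from_intro d.

Fixpoint everywhere (P : forall Gamma A, ded Gamma A -> Prop)
    Gamma A (d : ded Gamma A) : Prop :=
  P _ _ d /\
  match d with
  | Hyp _ _ _ => True
  | AndI _ _ _ d1 d2 => everywhere P d1 /\ everywhere P d2
  | AndE1 _ _ _ d1 => everywhere P d1
  | AndE2 _ _ _ d1 => everywhere P d1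
  | ImpI _ _ _ d1 => everywhere P d1
  | ImpE _ _ _ d1 d2 => everywhere P d1 /\ everywhere P d2
  | OrI1 _ _ _ d1 => everywhere P d1
  | OrI2 _ _ _ d1 => everywhere P d1
  | OrE _ _ _ _ d1 d2 d3 =>
      [/\ everywhere P d1, everywhere P d2 & everywhere P d3]
  | BotE _ _ _ d1 => everywhere P d1
  | AllI _ _ d1 => everywhere P d1
  | AllE _ _ _ d1 d2 => everywhere P d1 /\ everywhere P d2
  | ExiI _ _ _ d1 d2 => everywhere P d1 /\ everywhere P d2
  | ExiE _ _ _ d1 d2 => everywhere P d1 /\ everywhere P d2
  | IdI _ _ d1 => everywhere P d1
  | IdE _ _ _ _ _ _ _ d1 d2 => everywhere P d1 /\ everywhere P d2
  | AD _ _ _ _ d1 => everywhere P d1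
  | ADId1 _ _ _ d1 => everywhere P d1
  | ADId2 _ _ _ d1 => everywhere P d1
  | FD _ _ _ _ d1 => everywhere P d1
  | IotaI _ _ _ _ d1 d2 d3 d4 =>
      [/\ everywhere P d1, everywhere P d2, everywhere P d3 & everywhere P d4]
  | IotaE1 _ _ _ _ d1 d2 => everywhere P d1 /\ everywhere P d2
  | IotaE2A _ _ _ _ _ _ _ d1 d2 d3 d4 d5 d6 =>
      [/\ everywhere P d1, everywhere P d2 & everywhere P d3] /\
      [/\ everywhere P d4, everywhere P d5 & everywhere P d6]
  end.

Definition normal Gamma A (d : ded Gamma A) : Prop :=
  everywhere (fun Gamma A (e : ded Gamma A) =>
                ~ maximal_formula e /\ ~ maximal_segment e) d.

End NormalForm.

(* Main.v *)
(** Normalisation by a Kripke model whose worlds are contexts ordered by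
    inclusion and whose atomic truths are normal deducibility.  Disjunctive
    formulas are interpreted through a continuation-style cover, which absorbs
    the permutative conversions.  Normal deducibility is first taken in a liberal
    form [nf]/[ne] that puts no side condition on Leibniz' Law and hence is closed
    under substitution of terms.  A neutral "the F is G" is unique in the model
    because iota E^2A infers s = t from s = s; where such an identity is then used
    in Leibniz' Law, the deduction is repaired at the very end by applying
    iota E^2A to the atomic formula directly. *)

Require Import Defs.
From mathcomp Require Import all_boot.
From Stdlib Require Import Classical FunctionalExtensionality.
From Stdlib Require List.
Import List(In, incl, incl_refl, incl_tran, incl_tl).

Set Implicit Arguments.
Unset Strict Implicit.
Unset Printing Implicit Defensive.

(** * Substitution *)

Section Substitutions.
Variable L : signature.
Implicit Types (t u : term L) (A B F : form L) (s r : nat -> term L).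

(** The recursion in [Fn] passes through a finite function, so the generated principle offers no
    hypothesis for the arguments. *)
Lemma term_nested_ind (P : term L -> Prop) :
  (forall n, P (Var n)) ->
  (forall f (ts : {ffun 'I_(farity f) -> term L}),
     (forall i, P (ts i)) -> P (Fn ts)) ->
  forall t, P t.
Proof.
move=> PV PF; fix IH 1 => -[n|f ts]; first exact: PV.
by apply: PF => i; apply: IH.
Qed.

Definition scons t s (n : nat) : term L := if n is m.+1 then s m else t.

Lemma eq_tsubst s r t :
  (forall n, toccurs n t -> s n = r n) -> tsubst s t = tsubst r t.
Proof.
elim/term_nested_ind: t => [n|f ts IH] /= E; first exact: E.
by congr Fn; apply/ffunP => i; rewrite !ffunE; apply: IH => n ni; apply: E; exists i.
Qed.

Lemma eq_subst A s r :
  (forall n, free_in n A -> s n = r n) -> subst s A = subst r A.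
Proof.
have eq_up s' r' B : (forall n, free_in n.+1 B -> s' n = r' n) ->
    forall n, free_in n B -> up s' n = up r' n.
  by move=> E [|n] //= fn; rewrite E.
elim: A s r => [p ts|t u|t||A IA B IB|A IA B IB|A IA B IB|A IA|A IA|A IA B IB] s r /= E.
- congr Pred; apply/ffunP => i; rewrite !ffunE.
  by apply: eq_tsubst => n ni; apply: E; exists i.
- by congr Id; apply: eq_tsubst => n ni; apply: E; [left|right].
- by congr Den; apply: eq_tsubst.
- by [].
- by congr And; [apply: IA|apply: IB] => n ni; apply: E; [left|right].
- by congr Or; [apply: IA|apply: IB] => n ni; apply: E; [left|right].
- by congr Imp; [apply: IA|apply: IB] => n ni; apply: E; [left|right].
- by congr All; apply/IA/eq_up.
- by congr Exi; apply/IA/eq_up.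
- congr Iota; [apply: IA|apply: IB]; apply: eq_up => n ni; apply: E;
    by [left|right].
Qed.

Lemma tsubst_comp s r t : tsubst s (tsubst r t) = tsubst (tsubst s \o r) t.
Proof.
elim/term_nested_ind: t => [n|f ts IH] //=.
by congr Fn; apply/ffunP => i; rewrite !ffunE.
Qed.

Lemma tsubst_Var t : tsubst Var t = t.
Proof.
elim/term_nested_ind: t => [n|f ts IH] //=.
by congr Fn; apply/ffunP => i; rewrite ffunE.
Qed.

Lemma up_comp s r : tsubst (up s) \o up r = up (tsubst s \o r).
Proof.
by apply: functional_extensionality => -[|n] //=; rewrite /tshift !tsubst_comp.
Qed.

Lemma up_Var : up (@Var L) = Var.
Proof. by apply: functional_extensionality => -[|n]. Qed.

Lemma subst_comp A s r : subst s (subst r A) = subst (tsubst s \o r) A.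
Proof.
elim: A s r => [p ts|t u|t||A IA B IB|A IA B IB|A IA B IB|A IA|A IA|A IA B IB] s r /=;
  rewrite ?tsubst_comp ?IA ?IB ?up_comp //.
by congr Pred; apply/ffunP => i; rewrite !ffunE tsubst_comp.
Qed.

Lemma subst_Var A : subst Var A = A.
Proof.
elim: A => [p ts|t u|t||A IA B IB|A IA B IB|A IA B IB|A IA|A IA|A IA B IB] /=;
  rewrite ?up_Var ?tsubst_Var ?IA ?IB //.
by congr Pred; apply/ffunP => i; rewrite !ffunE tsubst_Var.
Qed.

Lemma subst_scons_comp s r t :
  tsubst (scons t s) \o up r = scons t (tsubst s \o r).
Proof.
by apply: functional_extensionality => -[|n] //=; rewrite /tshift tsubst_comp.
Qed.

Lemma inst_subst_up A s t : inst (subst (up s) A) t = subst (scons t s) A.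
Proof.
rewrite /inst subst_comp (subst_scons_comp Var); congr subst.
by apply: functional_extensionality => -[|n] //=; rewrite tsubst_Var.
Qed.

Lemma subst_inst A s t : subst s (inst A t) = subst (scons (tsubst s t) s) A.
Proof.
rewrite /inst subst_comp; congr subst.
by apply: functional_extensionality => -[|n].
Qed.

Lemma subst_up_inst A s t :
  subst s (inst A t) = inst (subst (up s) A) (tsubst s t).
Proof. by rewrite inst_subst_up subst_inst. Qed.

Lemma tsubst_up_tshift s t : tsubst (up s) (tshift t) = tshift (tsubst s t).
Proof. by rewrite /tshift !tsubst_comp. Qed.

Lemma subst_up_shift A s : subst (up s) (shift A) = shift (subst s A).
Proof. by rewrite /shift !subst_comp. Qed.

Lemma atomic_subst A s : atomic (subst s A) = atomic A.
Proof. by case: A. Qed.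

Lemma In_map (T U : Type) (f : T -> U) x l : In x l -> In (f x) (map f l).
Proof. by elim: l => //= y l IH [->|/IH]; [left|right]. Qed.

Lemma In_map_inv (T U : Type) (f : T -> U) y l :
  In y (map f l) -> exists x, f x = y /\ In x l.
Proof.
elim: l => //= x l IH [<-|/IH [z [<- zl]]]; first by exists x; split=> //; left.
by exists z; split=> //; right.
Qed.

(** * Fresh variables *)

Fixpoint tbound t : nat :=
  match t with Var n => n.+1 | Fn f ts => \max_i tbound (ts i) end.

(** Binders do not decrement the bound: it need not be tight, since it only has to exceed every free
    index. *)
Fixpoint bound A : nat :=
  match A with
  | Pred p ts => \max_i tbound (ts i)
  | Id t u => maxn (tbound t) (tbound u)
  | Den t => tbound t
  | Bot => 0
  | And A B | Or A B | Imp A B | Iota A B => maxn (bound A) (bound B)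
  | All A | Exi A => bound A
  end.

Lemma toccurs_bound n t : toccurs n t -> n < tbound t.
Proof.
elim/term_nested_ind: t => [m|f ts IH] /=; first by move=> ->.
by case=> i /IH ni; apply: leq_trans ni (leq_bigmax i).
Qed.

Lemma free_in_bound n A : free_in n A -> n < bound A.
Proof.
elim: A n => [p ts|t u|t||A IA B IB|A IA B IB|A IA B IB|A IA|A IA|A IA B IB] n /=.
- by case=> i /toccurs_bound ni; apply: leq_trans ni (leq_bigmax i).
- by rewrite leq_max; case=> /toccurs_bound ->; rewrite ?orbT.
- exact: toccurs_bound.
- by [].
- by rewrite leq_max; case=> [/IA|/IB] ->; rewrite ?orbT.
- by rewrite leq_max; case=> [/IA|/IB] ->; rewrite ?orbT.
- by rewrite leq_max; case=> [/IA|/IB] ->; rewrite ?orbT.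
- by move=> /IA/ltnW.
- by move=> /IA/ltnW.
- by rewrite leq_max; case=> [/IA|/IB] /ltnW ->; rewrite ?orbT.
Qed.

Lemma fresh_exists (l : seq (form L)) :
  exists y, forall A, In A l -> ~ free_in y A.
Proof.
exists (foldr maxn 0 (map bound l)) => A Al /free_in_bound; apply/negP; rewrite -leqNgt.
elim: l Al => //= B l IH [->|/IH]; first by rewrite leq_maxl.
by move=> le; apply: leq_trans le (leq_maxr _ _).
Qed.

(** Turns a named variable [y] into the eigenvariable at index 0: formulas without [y] are merely
    shifted, and the instance of a body at a fresh [y] becomes the body again. *)
Definition rename_to0 (y n : nat) : term L := if n == y then Var 0 else Var n.+1.

Lemma subst_rename_to0 y A : ~ free_in y A -> subst (rename_to0 y) A = shift A.
Proof.
move=> fy; apply: eq_subst => n fn; rewrite /rename_to0.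
by case: eqP => // ny; case: fy; rewrite -ny.
Qed.

Lemma subst_rename_to0_inst y A :
  ~ free_in y.+1 A -> subst (rename_to0 y) (inst A (Var y)) = A.
Proof.
move=> fy; rewrite subst_inst -[RHS]subst_Var; apply: eq_subst => -[|n] fn /=.
  by rewrite /rename_to0 eqxx.
by rewrite /rename_to0; case: eqP => // ny; case: fy; rewrite -ny.
Qed.

End Substitutions.

(** * Liberal normal deductions *)

(** [ne] collects what may serve as a major premise. The rules with atomic conclusions belong to it,
    as no introduction yields an atomic formula; the eliminations of [Or] and [Exi] and [nf_IotaE1]
    stay in [nf], since they may end a segment begun by an introduction. *)
Inductive nf (L : signature) : seq (form L) -> form L -> Prop :=
| nf_ne Gamma A : ne Gamma A -> nf Gamma A
| nf_AndI Gamma A B : nf Gamma A -> nf Gamma B -> nf Gamma (And A B)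
| nf_ImpI Gamma A B : nf (A :: Gamma) B -> nf Gamma (Imp A B)
| nf_OrI1 Gamma A B : nf Gamma A -> nf Gamma (Or A B)
| nf_OrI2 Gamma A B : nf Gamma B -> nf Gamma (Or A B)
| nf_OrE Gamma A B C :
    ne Gamma (Or A B) -> nf (A :: Gamma) C -> nf (B :: Gamma) C -> nf Gamma C
| nf_AllI Gamma A : nf (Den (Var 0) :: map (@shift L) Gamma) A -> nf Gamma (All A)
| nf_ExiI Gamma A t : nf Gamma (inst A t) -> nf Gamma (Den t) -> nf Gamma (Exi A)
| nf_ExiE Gamma A C :
    ne Gamma (Exi A) ->
    nf (A :: Den (Var 0) :: map (@shift L) Gamma) (shift C) -> nf Gamma C
| nf_IotaI Gamma F G t :
    nf Gamma (inst F t) -> nf Gamma (inst G t) -> nf Gamma (Den t) ->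
    nf (F :: Den (Var 0) :: map (@shift L) Gamma) (Id (Var 0) (tshift t)) ->
    nf Gamma (Iota F G)
| nf_IotaE1 Gamma F G C :
    ne Gamma (Iota F G) ->
    nf (F :: G :: Den (Var 0) :: map (@shift L) Gamma) (shift C) -> nf Gamma C
with ne (L : signature) : seq (form L) -> form L -> Prop :=
| ne_Hyp Gamma A : In A Gamma -> ne Gamma A
| ne_AndE1 Gamma A B : ne Gamma (And A B) -> ne Gamma A
| ne_AndE2 Gamma A B : ne Gamma (And A B) -> ne Gamma B
| ne_ImpE Gamma A B : ne Gamma (Imp A B) -> nf Gamma A -> ne Gamma B
| ne_BotE Gamma B : atomic B -> nf Gamma Bot -> ne Gamma B
| ne_AllE Gamma A t : ne Gamma (All A) -> nf Gamma (Den t) -> ne Gamma (inst A t)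
| ne_IdI Gamma t : nf Gamma (Den t) -> ne Gamma (Id t t)
| ne_IdE Gamma A t1 t2 :
    atomic A -> nf Gamma (Id t1 t2) -> nf Gamma (inst A t1) ->
    ne Gamma (inst A t2)
| ne_AD Gamma p (ts : {ffun 'I_(parity p) -> term L}) i :
    nf Gamma (Pred ts) -> ne Gamma (Den (ts i))
| ne_ADId1 Gamma t1 t2 : nf Gamma (Id t1 t2) -> ne Gamma (Den t1)
| ne_ADId2 Gamma t1 t2 : nf Gamma (Id t1 t2) -> ne Gamma (Den t2)
| ne_FD Gamma f (ts : {ffun 'I_(farity f) -> term L}) i :
    nf Gamma (Den (Fn ts)) -> ne Gamma (Den (ts i))
| ne_IotaE2A Gamma F G A t1 t2 :
    atomic A ->
    ne Gamma (Iota F G) -> nf Gamma (Den t1) -> nf Gamma (Den t2) ->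
    nf Gamma (inst F t1) -> nf Gamma (inst F t2) -> nf Gamma (inst A t1) ->
    ne Gamma (inst A t2).

Scheme nf_ne_ind := Induction for nf Sort Prop
  with ne_nf_ind := Induction for ne Sort Prop.
Combined Scheme nf_ne_mutind from nf_ne_ind, ne_nf_ind.

(** * Closure under substitution and weakening *)

Section Renaming.
Variable L : signature.
Implicit Types (t u : term L) (A B C F G : form L) (s r : nat -> term L).
Implicit Types (Gamma Delta : seq (form L)).

Definition ctx_morph s Gamma Delta := forall B, In B Gamma -> In (subst s B) Delta.

Lemma ctx_morph_cons s Gamma Delta A :
  ctx_morph s Gamma Delta -> ctx_morph s (A :: Gamma) (subst s A :: Delta).
Proof. by move=> m B /= [->|/m]; [left|right]. Qed.

Lemma ctx_morph_shift s Gamma Delta :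
  ctx_morph s Gamma Delta ->
  ctx_morph (up s) (map (@shift L) Gamma) (map (@shift L) Delta).
Proof.
move=> m B BG; have [C [<- CG]] := In_map_inv BG.
by rewrite subst_up_shift; apply/In_map/m.
Qed.

(** The target context only has to contain the substituted assumptions, so one induction gives
    weakening (identity substitution) as well as the renaming of eigenvariables. *)
Lemma nf_ne_subst :
  (forall Gamma A, nf Gamma A ->
     forall s Delta, ctx_morph s Gamma Delta -> nf Delta (subst s A)) /\
  (forall Gamma A, ne Gamma A ->
     forall s Delta, ctx_morph s Gamma Delta -> ne Delta (subst s A)).
Proof.
(* The morphism needed in premises that have an eigenvariable. *)
have open := fun s Gamma Delta m =>
  @ctx_morph_cons (up s) _ _ (Den (Var 0)) (@ctx_morph_shift s Gamma Delta m).
apply: (nf_ne_mutind (L := L)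
  (P := fun Gamma A _ =>
     forall s Delta, ctx_morph s Gamma Delta -> nf Delta (subst s A))
  (P0 := fun Gamma A _ =>
     forall s Delta, ctx_morph s Gamma Delta -> ne Delta (subst s A))) => /=.
- by move=> Gamma A _ IH s Delta m; apply/nf_ne/IH.
- by move=> Gamma A B _ I1 _ I2 s Delta m; apply: nf_AndI; auto.
- by move=> Gamma A B _ I1 s Delta m; apply/nf_ImpI/I1/ctx_morph_cons.
- by move=> Gamma A B _ I1 s Delta m; apply/nf_OrI1/I1.
- by move=> Gamma A B _ I1 s Delta m; apply/nf_OrI2/I1.
- move=> Gamma A B C _ I1 _ I2 _ I3 s Delta m.
  by apply: (nf_OrE (I1 _ _ m)); [apply: I2|apply: I3]; apply: ctx_morph_cons.
- by move=> Gamma A _ I1 s Delta m; apply/nf_AllI/I1/open.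
- move=> Gamma A t _ I1 _ I2 s Delta m.
  by apply: (nf_ExiI (t := tsubst s t)); rewrite -?subst_up_inst; auto.
- move=> Gamma A C _ I1 _ I2 s Delta m.
  apply: (nf_ExiE (I1 _ _ m)); rewrite -subst_up_shift.
  by apply/I2/ctx_morph_cons/open.
- move=> Gamma F G t _ I1 _ I2 _ I3 _ I4 s Delta m.
  apply: (nf_IotaI (t := tsubst s t)); rewrite -?subst_up_inst; auto.
  by rewrite -tsubst_up_tshift; apply/(I4 (up s))/ctx_morph_cons/open.
- move=> Gamma F G C _ I1 _ I2 s Delta m.
  apply: (nf_IotaE1 (I1 _ _ m)); rewrite -subst_up_shift.
  by apply/I2/ctx_morph_cons/ctx_morph_cons/open.
- by move=> Gamma A AG s Delta m; apply/ne_Hyp/m.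
- by move=> Gamma A B _ I1 s Delta m; apply: ne_AndE1 (I1 _ _ m).
- by move=> Gamma A B _ I1 s Delta m; apply: ne_AndE2 (I1 _ _ m).
- by move=> Gamma A B _ I1 _ I2 s Delta m; apply: ne_ImpE (I1 _ _ m) (I2 _ _ m).
- move=> Gamma B aB _ I1 s Delta m.
  by apply: ne_BotE (I1 _ _ m); rewrite atomic_subst.
- move=> Gamma A t _ I1 _ I2 s Delta m.
  by rewrite subst_up_inst; apply: ne_AllE (I1 _ _ m) (I2 _ _ m).
- by move=> Gamma t _ I1 s Delta m; apply: ne_IdI (I1 _ _ m).
- move=> Gamma A t1 t2 aA _ I1 _ I2 s Delta m; rewrite subst_up_inst.
  apply: ne_IdE (I1 _ _ m) _; rewrite ?atomic_subst //.
  by rewrite -subst_up_inst; apply: I2.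
- move=> Gamma p ts i _ I1 s Delta m.
  by have := ne_AD i (I1 _ _ m); rewrite ffunE.
- by move=> Gamma t1 t2 _ I1 s Delta m; apply: ne_ADId1 (I1 _ _ m).
- by move=> Gamma t1 t2 _ I1 s Delta m; apply: ne_ADId2 (I1 _ _ m).
- move=> Gamma f ts i _ I1 s Delta m.
  by have := ne_FD i (I1 _ _ m); rewrite ffunE.
- move=> Gamma F G A t1 t2 aA _ I1 _ I2 _ I3 _ I4 _ I5 _ I6 s Delta m.
  rewrite subst_up_inst.
  apply: ne_IotaE2A (I1 _ _ m) (I2 _ _ m) (I3 _ _ m) _ _ _;
    rewrite ?atomic_subst // -subst_up_inst; auto.
Qed.

Lemma nf_weaken Gamma Delta A : incl Gamma Delta -> nf Gamma A -> nf Delta A.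
Proof.
move=> GD d; rewrite -[A]subst_Var; apply: (proj1 nf_ne_subst _ _ d) => B /GD.
by rewrite subst_Var.
Qed.

Lemma ne_weaken Gamma Delta A : incl Gamma Delta -> ne Gamma A -> ne Delta A.
Proof.
move=> GD d; rewrite -[A]subst_Var; apply: (proj2 nf_ne_subst _ _ d) => B /GD.
by rewrite subst_Var.
Qed.

Lemma ctx_morph_rename_to0 y Gamma :
  (forall B, In B Gamma -> ~ free_in y B) ->
  ctx_morph (rename_to0 L y) (Den (Var y) :: Gamma)
    (Den (Var 0) :: map (@shift L) Gamma).
Proof.
move=> fy B /= [<-|BG] /=; first by left; rewrite /rename_to0 eqxx.
by right; rewrite subst_rename_to0; [exact: In_map|apply: fy].
Qed.

(** Worlds grow by inclusion, without shifting. The eigenvariable rules are therefore restated with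
    a named fresh [y] in the unshifted context; [rename_to0] brings the premise into the official
    form. *)
Lemma nf_AllI_fresh y Gamma A :
  (forall B, In B (All A :: Gamma) -> ~ free_in y B) ->
  nf (Den (Var y) :: Gamma) (inst A (Var y)) -> nf Gamma (All A).
Proof.
move=> fy /(proj1 nf_ne_subst _ _) d; apply: nf_AllI.
rewrite -{1}[A](@subst_rename_to0_inst _ y); last by apply: (fy (All A)); left.
by apply/d/ctx_morph_rename_to0 => B BG; apply: fy; right.
Qed.

Lemma nf_ExiE_fresh y Gamma A C :
  (forall B, In B (C :: Exi A :: Gamma) -> ~ free_in y B) ->
  ne Gamma (Exi A) ->
  nf (inst A (Var y) :: Den (Var y) :: Gamma) C -> nf Gamma C.
Proof.
move=> fy e /(proj1 nf_ne_subst _ _) d; apply: (nf_ExiE e).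
rewrite -(@subst_rename_to0 _ y); last by apply: fy; left.
rewrite -{1}[A](@subst_rename_to0_inst _ y); last by apply: (fy (Exi A)); right; left.
by apply/d/ctx_morph_cons/ctx_morph_rename_to0 => B BG; apply: fy; right; right.
Qed.

(** [Exi F] is listed because freshness of [y] for it means that [y.+1] is not free in the body [F];
    [Den t] stands in for the term [t]. *)
Lemma nf_IotaI_fresh y Gamma F G t :
  (forall B, In B (Exi F :: Den t :: Gamma) -> ~ free_in y B) ->
  nf Gamma (inst F t) -> nf Gamma (inst G t) -> nf Gamma (Den t) ->
  nf (inst F (Var y) :: Den (Var y) :: Gamma) (Id (Var y) t) ->
  nf Gamma (Iota F G).
Proof.
move=> fy f g e /(proj1 nf_ne_subst _ _) d; apply: (nf_IotaI f g e).
have [Et] := @subst_rename_to0 _ y (Den t) (fy _ (or_intror (or_introl erefl))).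
have -> : Id (Var 0) (tshift t) = subst (rename_to0 L y) (Id (Var y) t).
  by rewrite /= Et /rename_to0 eqxx.
rewrite -{1}[F](@subst_rename_to0_inst _ y); last by apply: (fy (Exi F)); left.
by apply/d/ctx_morph_cons/ctx_morph_rename_to0 => B BG; apply: fy; right; right.
Qed.

Lemma nf_IotaE1_fresh y Gamma F G C :
  (forall B, In B (C :: Exi F :: Exi G :: Gamma) -> ~ free_in y B) ->
  ne Gamma (Iota F G) ->
  nf (inst F (Var y) :: inst G (Var y) :: Den (Var y) :: Gamma) C -> nf Gamma C.
Proof.
move=> fy e /(proj1 nf_ne_subst _ _) d; apply: (nf_IotaE1 e).
rewrite -(@subst_rename_to0 _ y); last by apply: fy; left.
rewrite -{1}[F](@subst_rename_to0_inst _ y); last by apply: (fy (Exi F)); right; left.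
rewrite -{1}[G](@subst_rename_to0_inst _ y); last first.
  by apply: (fy (Exi G)); do 2 right; left.
apply/d/ctx_morph_cons/ctx_morph_cons/ctx_morph_rename_to0 => B BG.
by apply: fy; do 3 right.
Qed.

(** Leibniz' Law for the formula [x = u]-style context with the right side held at [t], started from
    [t = t], which strictness and reflexivity supply. *)
Lemma nf_id_sym Gamma t u : nf Gamma (Id t u) -> nf Gamma (Id u t).
Proof.
move=> e; have d : nf Gamma (Id t t) by apply/nf_ne/ne_IdI/nf_ne/(ne_ADId1 e).
have E v : inst (Id (Var 0) (tshift t)) v = Id v t.
  by rewrite /inst /= /tshift tsubst_comp; congr Id; apply: tsubst_Var.
by rewrite -E; apply/nf_ne/(ne_IdE _ e); rewrite ?E.
Qed.

End Renaming.

(** * The model *)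

Section Model.
Variable L : signature.
Notation ctx := (seq (form L)).
Implicit Types (t u : term L) (A B C F G : form L) (s r : nat -> term L).
Implicit Types (Gamma Delta Theta : ctx) (P Q : ctx -> Prop) (T U : term L -> ctx -> Prop).

(** A continuation monad over worlds whose answers are normal deductions of an arbitrary [C]. Such a
    goal allows an elimination with neutral major premise to be placed below the continuation. *)
Definition cover P Gamma :=
  forall Delta C, incl Gamma Delta ->
    (forall Theta, incl Delta Theta -> P Theta -> nf Theta C) -> nf Delta C.

Definition upward P := forall Gamma Delta, incl Gamma Delta -> P Gamma -> P Delta.

Lemma cover_bind P Q Gamma :
  cover P Gamma -> (forall Delta, incl Gamma Delta -> P Delta -> cover Q Delta) ->
  cover Q Gamma.
Proof.
move=> cP PQ Delta C GD k; apply: cP => // Theta DT pT.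
apply: (PQ Theta _ pT) => [|//|Xi TX]; first exact: incl_tran GD DT.
by apply: k; apply: incl_tran DT TX.
Qed.

Lemma cover_ret P Gamma : upward P -> P Gamma -> cover P Gamma.
Proof.
by move=> uP pG Delta C GD; apply; [apply: incl_refl|apply: uP GD pG].
Qed.

Lemma cover_map P Q Gamma :
  cover P Gamma -> (forall Delta, incl Gamma Delta -> P Delta -> Q Delta) ->
  cover Q Gamma.
Proof.
move=> cP PQ Delta C GD k; apply: cP => // Theta DT pT; apply: k => //.
by apply: PQ => //; apply: incl_tran GD DT.
Qed.

Lemma cover_upward P : upward (cover P).
Proof.
by move=> Gamma Delta GD cP Theta C DT; apply: cP; apply: incl_tran GD DT.
Qed.

Lemma cover_join P Gamma : cover (cover P) Gamma -> cover P Gamma.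
Proof. by move=> cP; apply: (cover_bind cP). Qed.

(** Normal deducibility is itself an answer, so the identity continuation leaves the monad. *)
Lemma cover_nf Gamma C : cover (fun Delta => nf Delta C) Gamma -> nf Gamma C.
Proof. by apply=> //; apply: incl_refl. Qed.

(** * Interpretation of formulas *)

Definition imp_val P Q Gamma :=
  forall Delta, incl Gamma Delta -> P Delta -> Q Delta.
(** As the logic is free, the domain of a world consists of the terms whose existence is normally
    deducible there. *)
Definition all_val T Gamma :=
  forall Delta t, incl Gamma Delta -> nf Delta (Den t) -> T t Delta.
Definition exi_wit T Gamma := exists2 t, nf Gamma (Den t) & T t Gamma.
(** Russell's analysis, with uniqueness demanded at all later worlds because domains grow. *)
Definition iota_wit T U Gamma :=
  exists t, [/\ nf Gamma (Den t), T t Gamma, U t Gamma &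
    forall Delta u, incl Gamma Delta -> nf Delta (Den u) -> T u Delta ->
      nf Delta (Id u t)].

(** The environment [s] keeps the recursion structural, since [inst A t] is not a subformula. [Bot]
    is treated like any atom, so inconsistent worlds are allowed. *)
Fixpoint val A (s : nat -> term L) : ctx -> Prop :=
  match A with
  | And A B => fun Gamma => val A s Gamma /\ val B s Gamma
  | Or A B => cover (fun Gamma => val A s Gamma \/ val B s Gamma)
  | Imp A B => imp_val (val A s) (val B s)
  | All A => all_val (fun t => val A (scons t s))
  | Exi A => cover (exi_wit (fun t => val A (scons t s)))
  | Iota F G => cover (iota_wit (fun t => val F (scons t s))
                                (fun t => val G (scons t s)))
  | A => fun Gamma => nf Gamma (subst s A)
  end.

Lemma val_atomic A s Gamma : atomic A -> val A s Gamma = nf Gamma (subst s A).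
Proof. by case: A. Qed.

Lemma val_upward A s : upward (val A s).
Proof.
elim: A s => [p ts|t u|t||A IA B IB|A IA B IB|A IA B IB|A IA|A IA|A IA B IB] s /=;
  try exact: cover_upward; move=> Gamma Delta GD; try exact: nf_weaken.
- by move=> [a b]; split; [apply: IA a|apply: IB b].
- by move=> ab Theta DT; apply: ab; apply: incl_tran GD DT.
- by move=> ab Theta t DT; apply: ab; apply: incl_tran GD DT.
Qed.

Lemma exi_wit_upward A s : upward (exi_wit (fun t => val A (scons t s))).
Proof.
by move=> Gamma Delta GD [t e a]; exists t; [apply: nf_weaken GD e|apply: val_upward GD a].
Qed.

Lemma iota_wit_upward F G s :
  upward (iota_wit (fun t => val F (scons t s)) (fun t => val G (scons t s))).
Proof.
move=> Gamma Delta GD [t [e f g q]]; exists t; split.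
- exact: nf_weaken GD e.
- exact: val_upward GD f.
- exact: val_upward GD g.
- by move=> Theta u DT; apply: q; apply: incl_tran GD DT.
Qed.

(** Every value absorbs covers: atoms by [cover_nf], positive formulas by joining, the others
    componentwise or pointwise. This lets a cover be eliminated into any conclusion. *)
Lemma val_cover A s Gamma : cover (val A s) Gamma -> val A s Gamma.
Proof.
elim: A s Gamma => [p ts|t u|t||A IA B IB|A IA B IB|A IA B IB|A IA|A IA|A IA B IB] s Gamma /=;
  try exact: cover_nf; try exact: cover_join; move=> c.
- by split; [apply: IA|apply: IB]; apply: (cover_map c) => Delta _ [].
- move=> Delta GD a; apply: IB; apply: (cover_map (cover_upward GD c)).
  by move=> Theta DT; apply; [apply: incl_refl|apply: val_upward DT a].
- move=> Delta t GD a; apply: IA; apply: (cover_map (cover_upward GD c)).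
  by move=> Theta DT; apply; [apply: incl_refl|apply: nf_weaken DT a].
Qed.

(** Stated as an equality of predicates, by extensionality, so that it can be rewritten under the
    model's connectives. *)
Lemma val_subst A s r : val (subst r A) s = val A (tsubst s \o r).
Proof.
have under B : (forall s r, val (subst r B) s = val B (tsubst s \o r)) ->
    forall s r, (fun t => val (subst (up r) B) (scons t s)) =
                (fun t => val B (scons t (tsubst s \o r))).
  move=> IB s' r'; apply: functional_extensionality => t.
  by rewrite IB subst_scons_comp.
elim: A s r => [p ts|t u|t||A IA B IB|A IA B IB|A IA B IB|A IA|A IA|A IA B IB] s r;
  rewrite /= ?tsubst_comp ?(under A) ?(under B) ?IA ?IB //.
apply: functional_extensionality => Gamma; congr (nf Gamma (Pred _)).
by apply/ffunP => i; rewrite !ffunE tsubst_comp.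
Qed.

Lemma val_inst A s t : val (inst A t) s = val A (scons (tsubst s t) s).
Proof.
by rewrite val_subst; congr val; apply: functional_extensionality => -[|n].
Qed.

Lemma val_shift A s t : val (shift A) (scons t s) = val A s.
Proof. by rewrite val_subst. Qed.

(** The rule for [Bot] reaches atoms only; induction on [A] extends it to all formulas. *)
Lemma val_bot A s Gamma : nf Gamma Bot -> val A s Gamma.
Proof.
have bot B Delta : atomic B -> nf Delta Bot -> nf Delta B.
  by move=> aB b; apply/nf_ne/ne_BotE.
elim: A s Gamma => [p ts|t u|t||A IA B IB|A IA B IB|A IA B IB|A IA|A IA|A IA B IB] s Gamma b /=;
  try exact: bot.
- by split; auto.
- apply: cover_ret; last by left; apply: IA.
  by move=> ? ? ? [?|?]; [left|right]; apply: val_upward; eauto.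
- by move=> Delta GD _; apply/IB/(nf_weaken GD).
- by move=> Delta t GD _; apply/IA/(nf_weaken GD).
- apply: cover_ret; first exact: exi_wit_upward.
  (* Any term would do, since [Bot] yields its existence. *)
  by exists (Var 0); [apply: bot|apply: IA].
- apply: cover_ret; first exact: iota_wit_upward.
  exists (Var 0); split; [exact: bot|exact: IA|exact: IB|].
  by move=> Delta u GD _ _; apply/bot/(nf_weaken GD).
Qed.

(** * Soundness *)

Definition ctx_val s Gamma Delta := forall B, In B Gamma -> val B s Delta.

Lemma ctx_val_upward s Gamma : upward (ctx_val s Gamma).
Proof. by move=> Delta Theta DT g B /g; apply: val_upward. Qed.

Lemma ctx_val_cons s A Gamma Delta :
  val A s Delta -> ctx_val s Gamma Delta -> ctx_val s (A :: Gamma) Delta.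
Proof. by move=> a g B /= [<-|/g]. Qed.

Lemma ctx_val_shift s t Gamma Delta :
  ctx_val s Gamma Delta -> ctx_val (scons t s) (map (@shift L) Gamma) Delta.
Proof. by move=> g B BG; have [C [<- /g]] := In_map_inv BG; rewrite val_shift. Qed.

Lemma soundness Gamma A (d : ded Gamma A) s Delta :
  ctx_val s Gamma Delta -> val A s Delta.
Proof.
elim: d s Delta => {Gamma A}.
- by move=> Gamma A AG s Delta; apply.
- by move=> Gamma A B _ I1 _ I2 s Delta g; split; auto.
- by move=> Gamma A B _ I1 s Delta /I1 [].
- by move=> Gamma A B _ I1 s Delta /I1 [].
- move=> Gamma A B _ I1 s Delta g Theta DT a.
  by apply: I1; apply: ctx_val_cons a _; apply: ctx_val_upward DT g.
- move=> Gamma A B _ I1 _ I2 s Delta g.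
  by apply: (I1 _ _ g) (I2 _ _ g); apply: incl_refl.
- move=> Gamma A B _ I1 s Delta g; apply: cover_ret; last by left; apply: I1.
  by move=> ? ? ? [?|?]; [left|right]; apply: val_upward; eauto.
- move=> Gamma A B _ I1 s Delta g; apply: cover_ret; last by right; apply: I1.
  by move=> ? ? ? [?|?]; [left|right]; apply: val_upward; eauto.
- move=> Gamma A B C _ I1 _ I2 _ I3 s Delta g.
  have /= c := I1 _ _ g; apply/val_cover/(cover_map c) => Theta DT.
  by case=> ab; [apply: I2|apply: I3]; apply: ctx_val_cons ab _;
    apply: ctx_val_upward DT g.
- by move=> Gamma B _ _ I1 s Delta /I1; apply: val_bot.
- move=> Gamma A _ I1 s Delta g Theta t DT e.
  by apply/I1/ctx_val_cons => //; apply/ctx_val_shift/(ctx_val_upward DT).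
- move=> Gamma A t _ I1 _ I2 s Delta g; rewrite val_inst.
  by apply: (I1 _ _ g) (I2 _ _ g); apply: incl_refl.
- move=> Gamma A t _ I1 _ I2 s Delta g /=; apply: cover_ret; first exact: exi_wit_upward.
  by exists (tsubst s t); [apply: I2 g|rewrite -val_inst; apply: I1].
- move=> Gamma A C _ I1 _ I2 s Delta g.
  have /= c := I1 _ _ g; apply/val_cover/(cover_map c) => Theta DT [t e a].
  rewrite -(val_shift _ _ t); apply/I2/ctx_val_cons => //; apply/ctx_val_cons => //.
  exact/ctx_val_shift/(ctx_val_upward DT).
- by move=> Gamma t _ I1 s Delta /I1 e; apply/nf_ne/ne_IdI.
- move=> Gamma A t1 t2 aA _ _ _ I1 _ I2 s Delta g.
  have := I2 _ _ g; rewrite !val_atomic ?atomic_subst // !subst_up_inst => a.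
  by apply/nf_ne/ne_IdE/a; rewrite ?atomic_subst //; apply: I1 g.
- move=> Gamma p ts i _ I1 s Delta /I1 a.
  by have := ne_AD i a; rewrite ffunE; apply: nf_ne.
- by move=> Gamma t1 t2 _ I1 s Delta /I1 a; apply/nf_ne/(ne_ADId1 a).
- by move=> Gamma t1 t2 _ I1 s Delta /I1 a; apply/nf_ne/(ne_ADId2 a).
- move=> Gamma f ts i _ I1 s Delta /I1 a.
  by have := ne_FD i a; rewrite ffunE; apply: nf_ne.
- move=> Gamma F G t _ I1 _ I2 _ I3 _ I4 s Delta g /=.
  apply: cover_ret; first exact: iota_wit_upward.
  exists (tsubst s t); split; rewrite -?val_inst; [exact: I3 g|exact: I1|exact: I2|].
  move=> Theta u DT e f.
  (* Uniqueness comes from evaluating the subdeduction with [u] for its eigenvariable. *)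
  have := I4 (scons u s) Theta; rewrite /= /tshift tsubst_comp; apply.
  apply/ctx_val_cons => //; apply/ctx_val_cons => //.
  exact/ctx_val_shift/(ctx_val_upward DT).
- move=> Gamma F G C _ I1 _ I2 s Delta g.
  have /= c := I1 _ _ g; apply/val_cover/(cover_map c) => Theta DT [t [e f h _]].
  rewrite -(val_shift _ _ t); apply/I2.
  do 3 apply/ctx_val_cons => //; exact/ctx_val_shift/(ctx_val_upward DT).
- move=> Gamma F G A t1 t2 aA _ I1 _ I2 _ I3 _ I4 _ I5 _ I6 s Delta g.
  have /= c := I1 _ _ g; apply/val_cover/(cover_map c) => Theta DT [t [_ _ _ q]].
  have gT := ctx_val_upward DT g.
  (* Both terms equal the witness [t], so Leibniz' Law is applied twice, passing from [t1] through
     [t] to [t2]. *)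
  have q1 : nf Theta (Id (tsubst s t1) t).
    by apply: (q _ _ (incl_refl _) (I2 _ _ gT)); rewrite -val_inst; apply: I4.
  have q2 : nf Theta (Id t (tsubst s t2)).
    apply: nf_id_sym; apply: (q _ _ (incl_refl _) (I3 _ _ gT)).
    by rewrite -val_inst; apply: I5.
  have aA' : atomic (subst (up s) A) by rewrite atomic_subst.
  have := I6 _ _ gT; rewrite !val_atomic ?atomic_subst // !subst_up_inst => a.
  by apply/nf_ne/(ne_IdE aA' q2)/nf_ne/(ne_IdE aA' q1).
Qed.

(** * Reflection and reification *)

Lemma incl_cons_tl A Gamma Delta : incl (A :: Gamma) Delta -> incl Gamma Delta.
Proof. by move=> GD B BG; apply: GD; right. Qed.

(** The two halves need a simultaneous induction because implication reifies its argument in order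
    to reflect, and conversely. For positive formulas, reflection inserts the elimination rule and
    reification leaves the cover by [cover_nf]. *)
Lemma reflect_reify A s Gamma :
  (ne Gamma (subst s A) -> val A s Gamma) /\ (val A s Gamma -> nf Gamma (subst s A)).
Proof.
elim: A s Gamma => [p ts|t u|t||A IA B IB|A IA B IB|A IA B IB|A IA|A IA|F IF G IG] s Gamma /=;
  try by split=> //; apply: nf_ne.
- split=> [e|[a b]]; last by apply: nf_AndI; [apply/(proj2 (IA _ _))|apply/(proj2 (IB _ _))].
  by split; [apply/(proj1 (IA _ _))/(ne_AndE1 e)|apply/(proj1 (IB _ _))/(ne_AndE2 e)].
- split=> [e Delta C GD k|c].
    apply: (nf_OrE (ne_weaken GD e)); apply: k; try exact/incl_tl/incl_refl.
      by left; apply/(proj1 (IA _ _))/ne_Hyp; left.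
    by right; apply/(proj1 (IB _ _))/ne_Hyp; left.
  apply/cover_nf/(cover_map c) => Delta GD [a|b].
    exact/nf_OrI1/(proj2 (IA _ _)).
  exact/nf_OrI2/(proj2 (IB _ _)).
- split=> [e Delta GD a|v].
    by apply/(proj1 (IB _ _))/(ne_ImpE (ne_weaken GD e))/(proj2 (IA _ _)).
  by apply/nf_ImpI/(proj2 (IB _ _))/v; [apply/incl_tl/incl_refl|apply/(proj1 (IA _ _))/ne_Hyp; left].
- split=> [e Delta t GD a|v].
    by apply/(proj1 (IA _ _)); rewrite -inst_subst_up; apply/(ne_AllE (ne_weaken GD e)).
  have [y fy] := fresh_exists (All (subst (up s) A) :: Gamma).
  apply: (nf_AllI_fresh fy); rewrite inst_subst_up; apply/(proj2 (IA _ _))/v.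
    exact/incl_tl/incl_refl.
  by apply/nf_ne/ne_Hyp; left.
- split=> [e Delta C GD k|c].
    (* The answer [C] is arbitrary, so [y] must be fresh for it too. *)
    have [y fy] := fresh_exists (C :: Exi (subst (up s) A) :: Delta).
    apply: (nf_ExiE_fresh fy (ne_weaken GD e)); apply: k.
      exact/incl_tl/incl_tl/incl_refl.
    exists (Var y); first by apply/nf_ne/ne_Hyp; right; left.
    by apply/(proj1 (IA _ _))/ne_Hyp; left; rewrite inst_subst_up.
  apply/cover_nf/(cover_map c) => Delta GD [t e a].
  by apply: (nf_ExiI (t := t)) => //; rewrite inst_subst_up; apply/(proj2 (IA _ _)).
- split=> [e Delta C GD k|c].
    have [y fy] :=
      fresh_exists (C :: Exi (subst (up s) F) :: Exi (subst (up s) G) :: Delta).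
    have eD := ne_weaken GD e; apply: (nf_IotaE1_fresh fy eD); apply: k.
      exact/incl_tl/incl_tl/incl_tl/incl_refl.
    have f : ne [:: inst (subst (up s) F) (Var y), inst (subst (up s) G) (Var y),
        Den (Var y) & Delta] (inst (subst (up s) F) (Var y)).
      by apply: ne_Hyp; left.
    exists (Var y); split.
    + by apply/nf_ne/ne_Hyp; right; right; left.
    + by apply/(proj1 (IF _ _)); rewrite -inst_subst_up.
    + by apply/(proj1 (IG _ _))/ne_Hyp; right; left; rewrite inst_subst_up.
    move=> Theta u DT eu fu; apply: nf_ne.
    (* Uniqueness of the witness [y]: iota E^2A for the formula [u = x] leads from [u = u] to
       [u = y]. These are the identities that may later have to be repaired. *)
    have E v : inst (Id (tshift u) (Var 0)) v = Id u v.
      by rewrite /inst /= /tshift tsubst_comp; congr Id; apply: tsubst_Var.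
    rewrite -E; apply: (@ne_IotaE2A _ _ (subst (up s) F) (subst (up s) G) _ u) => //.
    + by exact: ne_weaken (incl_cons_tl (incl_cons_tl (incl_cons_tl DT))) eD.
    + by apply/nf_ne/ne_Hyp/DT; right; right; left.
    + by rewrite inst_subst_up; apply/(proj2 (IF _ _)).
    + exact/(nf_weaken DT)/nf_ne.
    + by rewrite E; apply/nf_ne/ne_IdI.
  apply/cover_nf/(cover_map c) => Delta GD [t [e f g q]].
  have [y fy] := fresh_exists (Exi (subst (up s) F) :: Den t :: Delta).
  apply: (nf_IotaI_fresh fy) => //; rewrite ?inst_subst_up; try exact/(proj2 (IF _ _)); try exact/(proj2 (IG _ _)).
  (* The uniqueness clause is used at the fresh [y], for which [F] holds by reflecting the
     assumption. *)
  apply: q; first exact/incl_tl/incl_tl/incl_refl.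
    by apply/nf_ne/ne_Hyp; right; left.
  by apply/(proj1 (IF _ _))/ne_Hyp; left.
Qed.

(** Evaluation at the world [Gamma] in the identity environment: assumptions hold by reflection, and
    the value of [A] is reified. *)
Lemma ded_nf Gamma A : ded Gamma A -> nf Gamma A.
Proof.
move=> d; rewrite -[A]subst_Var; apply: (proj2 (reflect_reify _ _ _)); apply: (soundness d) => B BG.
by apply: (proj1 (reflect_reify _ _ _)); rewrite subst_Var; apply: ne_Hyp.
Qed.

End Model.

(** * From liberal to normal deductions *)

Section Realisation.
Variable L : signature.
Implicit Types (t u : term L) (A B C F G : form L) (Gamma : seq (form L)).

(** Introductions conclude compound formulas, and a segment repeats one formula up to shifting. *)
Lemma atomic_not_segment Gamma A (d : ded Gamma A) :
  atomic A -> ~ segment_from_intro d.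
Proof.
elim: d => {Gamma A} //=; try by move=> *; case.
- by move=> Gamma A B C _ _ d1 I1 d2 I2 a [//|[/I1|/I2]]; apply.
- by move=> Gamma A C _ _ d1 I1 a [//|/I1]; apply; rewrite atomic_subst.
- by move=> Gamma F G C _ _ d1 I1 a [//|/I1]; apply; rewrite atomic_subst.
Qed.

(** A segment may have length one, so a major premise that ends no introduced segment is no
    introduced formula either. *)
Lemma by_intro_segment Gamma A (d : ded Gamma A) :
  by_intro d -> segment_from_intro d.
Proof. by case: d => //=; left. Qed.

Definition normal_ded Gamma A := exists d : ded Gamma A, normal d.
Definition neutral_ded Gamma A :=
  exists2 d : ded Gamma A, normal d & ~ segment_from_intro d.

Lemma neutral_atomic Gamma A : atomic A -> normal_ded Gamma A -> neutral_ded Gamma A.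
Proof. by move=> aA [d nd]; exists d => //; apply: atomic_not_segment. Qed.

Lemma neutral_IotaE2A Gamma F G A t1 t2 :
  atomic A -> neutral_ded Gamma (Iota F G) ->
  normal_ded Gamma (Den t1) -> normal_ded Gamma (Den t2) ->
  normal_ded Gamma (inst F t1) -> normal_ded Gamma (inst F t2) ->
  normal_ded Gamma (inst A t1) -> neutral_ded Gamma (inst A t2).
Proof.
move=> aA [m nm sm] [d1 n1] [d2 n2] [d3 n3] [d4 n4] [d5 n5].
exists (IotaE2A (G := G) aA m d1 d2 d3 d4 d5); last by case.
split=> //; split=> //; case=> // /by_intro_segment; exact: sm.
Qed.

(** Recovers the premises from which an iota identity was inferred. The formula [B] is kept apart
    from the identity so that case analysis on [d] meets a variable index. *)
Lemma iota_identity_inv Gamma B (d : ded Gamma B) t1 t2 :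
  B = Id t1 t2 -> by_iota_identity d -> normal d ->
  exists F G, [/\ neutral_ded Gamma (Iota F G),
    normal_ded Gamma (Den t1), normal_ded Gamma (Den t2),
    normal_ded Gamma (inst F t1) & normal_ded Gamma (inst F t2)].
Proof.
case: d => // {}Gamma F G A u1 u2 aA m d1 d2 d3 d4 d5 E [_ E2]
  [[_ sm] [[nm n1 n2] [n3 n4 _]]].
move: E; rewrite E2 => -[<- <-].
exists F, G; split; [by exists m|by exists d1|by exists d2|by exists d3|by exists d4].
Qed.

(** The repair of Leibniz' Law. If its side conditions fail, the premise already is the conclusion;
    if the identity stems from iota E^2A, that rule is applied to [A] directly with the same
    premises on [F]. *)
Lemma neutral_IdE Gamma A t1 t2 :
  atomic A -> normal_ded Gamma (Id t1 t2) -> normal_ded Gamma (inst A t1) ->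
  neutral_ded Gamma (inst A t2).
Proof.
move=> aA [e ne] na.
(* Equality of terms need not be decidable over an arbitrary signature. *)
have [<-|t12] := classic (t1 = t2).
  by apply: neutral_atomic na; rewrite atomic_subst.
have [fA|fA] := classic (free_in 0 A); last first.
  have -> : inst A t2 = inst A t1 by apply: eq_subst => -[|n].
  by apply: neutral_atomic na; rewrite atomic_subst.
have [ie|ie] := classic (by_iota_identity e).
  have [F [G [nm n1 n2 n3 n4]]] := iota_identity_inv erefl ie ne.
  exact: neutral_IotaE2A nm n1 n2 n3 n4 na.
case: na => d nd; exists (IdE aA fA t12 e d); last by case.
by split=> //; split=> //; case.
Qed.

(** Neutrality of major premises excludes maximal formulas and segments at once. Each instance of
    [ne_IdE] is examined after its premises are translated, so identities created by earlier repairs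
    are caught as well. *)
Lemma nf_normal :
  (forall Gamma A, nf Gamma A -> normal_ded Gamma A) /\
  (forall Gamma A, ne Gamma A -> neutral_ded Gamma A).
Proof.
apply: (nf_ne_mutind (L := L) (P := fun Gamma A _ => normal_ded Gamma A)
  (P0 := fun Gamma A _ => neutral_ded Gamma A)).
- by move=> Gamma A _ [d nd _]; exists d.
- move=> Gamma A B _ [d1 n1] _ [d2 n2]; exists (AndI d1 d2).
  by split=> //; split=> //; case.
- by move=> Gamma A B _ [d1 n1]; exists (ImpI d1); split=> //; split=> //; case.
- by move=> Gamma A B _ [d1 n1]; exists (OrI1 B d1); split=> //; split=> //; case.
- by move=> Gamma A B _ [d1 n1]; exists (OrI2 A d1); split=> //; split=> //; case.
- move=> Gamma A B C _ [m nm sm] _ [d1 n1] _ [d2 n2]; exists (OrE m d1 d2).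
  by split=> //; split=> //; case=> // /by_intro_segment.
- by move=> Gamma A _ [d1 n1]; exists (AllI d1); split=> //; split=> //; case.
- move=> Gamma A t _ [d1 n1] _ [d2 n2]; exists (ExiI d1 d2).
  by split=> //; split=> //; case.
- move=> Gamma A C _ [m nm sm] _ [d1 n1]; exists (ExiE m d1).
  by split=> //; split=> //; case=> // /by_intro_segment.
- move=> Gamma F G t _ [d1 n1] _ [d2 n2] _ [d3 n3] _ [d4 n4].
  by exists (IotaI d1 d2 d3 d4); split=> //; split=> //; case.
- move=> Gamma F G C _ [m nm sm] _ [d1 n1]; exists (IotaE1 m d1).
  by split=> //; split=> //; case=> // /by_intro_segment.
- move=> Gamma A AG; exists (Hyp AG); last by case.
  by split=> //; split=> //; case.
- move=> Gamma A B _ [m nm sm]; exists (AndE1 m); last by case.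
  by split=> //; split=> //; case=> // /by_intro_segment.
- move=> Gamma A B _ [m nm sm]; exists (AndE2 m); last by case.
  by split=> //; split=> //; case=> // /by_intro_segment.
- move=> Gamma A B _ [m nm sm] _ [d1 n1]; exists (ImpE m d1); last by case.
  by split=> //; split=> //; case=> // /by_intro_segment.
- move=> Gamma B aB _ [d nd]; exists (BotE aB d); last by case.
  by split=> //; split=> //; case.
- move=> Gamma A t _ [m nm sm] _ [d1 n1]; exists (AllE m d1); last by case.
  by split=> //; split=> //; case=> // /by_intro_segment.
- move=> Gamma t _ [d nd]; exists (IdI d); last by case.
  by split=> //; split=> //; case.
- by move=> Gamma A t1 t2 aA _ n1 _ n2; apply: neutral_IdE n1 n2.
- move=> Gamma p ts i _ [d nd]; exists (AD i d); last by case.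
  by split=> //; split=> //; case.
- move=> Gamma t1 t2 _ [d nd]; exists (ADId1 d); last by case.
  by split=> //; split=> //; case.
- move=> Gamma t1 t2 _ [d nd]; exists (ADId2 d); last by case.
  by split=> //; split=> //; case.
- move=> Gamma f ts i _ [d nd]; exists (FD i d); last by case.
  by split=> //; split=> //; case.
- move=> Gamma F G A t1 t2 aA _ nm _ n1 _ n2 _ n3 _ n4 _ n5.
  exact: neutral_IotaE2A nm n1 n2 n3 n4 n5.
Qed.

End Realisation.

Theorem theorem2 (L : signature) (Gamma : seq (form L)) (A : form L)
    (Pi : ded Gamma A) :
  exists Pi' : ded Gamma A, normal Pi'.
Proof. exact: (proj1 (nf_normal L)) _ _ (ded_nf Pi). Qed.
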